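(* For nonnegative integers $h,\ell,m,n$, let $a_n(h,\ell,m)$ be the number of $F$-paths $Q$ of length $n$ with $\mathrm{ht}(Q)=m$, $\mathrm{north}(Q)=\ell$ and $\mathrm{aone}(Q)=h$, and let an asterisk in place of an argument denote the sum over all nonnegative integer values of that argument. Then \begin{align*} a_n(h,\ell,\ast)&=\frac{1}{n+1}\binom{n+1}{\ell+1}\binom{n-\ell}{h}\binom{n+1}{2\ell+h-n},\\ a_n(h,\ast,m)&=\frac{m+1}{n+1}\binom{n+1}{h}\sum_{i\ge0}\binom{n-h+1}{i+1}\binom{n-m-1}{2n-h-2i-1},\\ a_n(\ast,\ell,m)&=\frac{m+1}{n+1}\binom{n+1}{\ell+1}\binom{2n-\ell-m-1}{2n-2\ell-1},\\ a_n(h,\ast,\ast)&=\frac{1}{n+1}\binom{n+1}{h}\sum_{i\ge0}\binom{n-h+1}{i}\binom{n+1}{2i+h+1},\\ a_n(\ast,\ell,\ast)&=\frac{1}{n+1}\binom{n+1}{\ell+1}\binom{2n-\ell+1}{\ell},\\ a_n(\ast,\ast,m)&=\frac{m+1}{n+1}\sum_{i\ge0}\binom{n+1}{i}\binom{n-m+i-1}{2i-1},\\ a_n(\ast,\ast,\ast)&=\frac{1}{n+1}\sum_{i\ge0}\binom{n+1}{i+1}\binom{2n-i+1}{i}. \end{align*}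
   Context: Let $F=\{(a,b)\in\mathbb{Z}^2 : a\ge 1,\ b\le 1\}\cup\{(0,1)\}$. An $F$-path of length $n$ is a lattice path in $\mathbb{Z}^2$ starting at $(0,0)$ with $n$ steps $s_1,\dots,s_n\in F$ such that each point $(x_i,y_i)=s_1+\cdots+s_i$ satisfies $x_i\le y_i$. For an $F$-path $Q$ of length $n$: $\mathrm{ht}(Q)=y_n-x_n$; $\mathrm{north}(Q)$ is the number of steps $(0,1)$ in $Q$; $\mathrm{aone}(Q)$ is the number of steps $(a,b)$ in $Q$ with $a=1$. Binomial convention: $\binom{p}{q}$ is the usual binomial coefficient if $0\le q\le p$; $\binom{-1}{-1}=1$; and $\binom{p}{q}=0$ for all other integers $p,q$. *)

(* Defs.v *)
From HB Require Import structures.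
From mathcomp Require Import all_boot all_order all_algebra finmap.
From mathcomp Require Import boolp classical_sets functions cardinality fsbigop.
From mathcomp Require Import zify.

Set Implicit Arguments.
Unset Strict Implicit.
Unset Printing Implicit Defensive.

Import Order.TTheory GRing.Theory Num.Theory.
Local Open Scope classical_set_scope.
Local Open Scope ring_scope.

Definition north_step : int * int := (0, 1).

Definition Fstep (s : int * int) : bool :=
  ((1 <= s.1) && (s.2 <= 1)) || (s == north_step).

Definition vertex (Q : seq (int * int)) (i : nat) : int * int :=
  \sum_(s <- take i Q) s.

Definition Fpath (n : nat) (Q : seq (int * int)) : Prop :=
  [/\ size Q = n,
      all Fstep Q &
      forall i : nat, (1 <= i <= n)%N -> (vertex Q i).1 <= (vertex Q i).2].

Definition ht (Q : seq (int * int)) : int :=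
  (vertex Q (size Q)).2 - (vertex Q (size Q)).1.

Definition north (Q : seq (int * int)) : nat := count_mem north_step Q.

Definition aone (Q : seq (int * int)) : nat := count (fun s => s.1 == 1) Q.

Definition Fpaths (n h l m : nat) : set (seq (int * int)) :=
  [set Q | [/\ Fpath n Q, ht Q = m%:Z, north Q = l & aone Q = h]].

(* a_n(h, l, m).  [fset_set] sends infinite sets to [fset0]; [finite_Fpaths] shows that this
   default value is never used here. *)
Definition num_Fpaths (n h l m : nat) : nat := #|` fset_set (Fpaths n h l m)|.

Definition binz (p q : int) : rat :=
  if (0 <= q) && (q <= p) then 'C(`|p|, `|q|)%:R
  else ((p == -1) && (q == -1))%:R.

(* Sums over all of nat are written \sum_(i \in [set: nat]), which denotes 0
   when infinitely many terms are nonzero.  [num_Fpaths_eq0] and [binz_eq0]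
   imply that the sums over h, l, m and the binomial sums have finite support. *)

Lemma binz_eq0 (p q : int) : 0 <= q -> p < q -> binz p q = 0.
Proof.
move=> q0 pq; rewrite /binz q0 leNgt pq /=.
have -> : (q == -1) = false by lia.
by rewrite andbF.
Qed.

Lemma vertexS Q i : (i < size Q)%N ->
  vertex Q i.+1 = vertex Q i + nth 0 Q i.
Proof. by move=> iQ; rewrite /vertex (take_nth 0)// -cats1 big_cat big_seq1. Qed.

Lemma Fpath_step n Q i : Fpath n Q -> (i < n)%N -> Fstep (nth 0 Q i).
Proof. by move=> [sQ /allP aQ _] ltin; apply/aQ/mem_nth; rewrite sQ. Qed.

Lemma Fpath_vertex n Q i : Fpath n Q -> (i <= n)%N ->
  [/\ 0 <= (vertex Q i).1, (vertex Q i).1 <= (vertex Q i).2 &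
      (vertex Q i).2 <= i%:Z].
Proof.
move=> pQ; elim: i => [_|i IH ltin]; first by rewrite /vertex take0 big_nil.
have [x0 xy yi] := IH (ltnW ltin).
have st := Fpath_step pQ ltin.
have [sQ _ hQ] := pQ; have := hQ i.+1 ltin; rewrite vertexS ?sQ//=.
move: st x0 xy yi; case: (vertex Q i) => x y; case: (nth 0 Q i) => a b.
rewrite /Fstep/= /north_step => /orP[/andP[]|/eqP[-> ->]]; split; lia.
Qed.

Lemma finite_Fpath n : finite_set [set Q | Fpath n Q].
Proof.
pose dec (p : 'I_(n + n).+1 * 'I_(n + n).+1) : int * int :=
  (p.1%:Z - n%:Z, p.2%:Z - n%:Z).
pose enc (s : int * int) : 'I_(n + n).+1 * 'I_(n + n).+1 :=
  (inord `|s.1 + n%:Z|, inord `|s.2 + n%:Z|).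
pose f (t : n.-tuple ('I_(n + n).+1 * 'I_(n + n).+1)) := map dec t.
apply: (@sub_finite_set _ _ (f @` setT)); last exact/finite_image/finite_finset.
move=> Q /= pQ; have [sQ _ _] := pQ.
have sz : size (map enc Q) == n by rewrite size_map sQ.
exists (Tuple sz) => //; rewrite /f/= -map_comp -[RHS]map_id.
apply/eq_in_map => s /(nthP 0)[i]; rewrite sQ => ltin <-.
have [x0 xy yi] := Fpath_vertex pQ (ltnW ltin).
have [] := Fpath_vertex pQ ltin; rewrite vertexS ?sQ//.
move: x0 xy yi; case: (vertex Q i) => x y; case: (nth 0 Q i) => a b /=.
move=> x0 xy yi xa0 xyab yb; rewrite /dec /enc /= !inordK; try lia.
by congr (_, _); lia.
Qed.

Lemma finite_Fpaths n h l m : finite_set (Fpaths n h l m).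
Proof. by apply: sub_finite_set (finite_Fpath n) => Q []. Qed.

Lemma num_Fpaths_eq0 n h l m :
  (n < h)%N || (n < l)%N || (n < m)%N -> num_Fpaths n h l m = 0%N.
Proof.
move=> big; rewrite /num_Fpaths.
suff -> : Fpaths n h l m = set0 by rewrite fset_set0 cardfs0.
apply/seteqP; split=> // Q [pQ hm hl hh].
have [sQ _ _] := pQ.
have [x0 _ yn] := Fpath_vertex pQ (leqnn n).
have := count_size (fun s : int * int => s.1 == 1) Q.
have := count_size (pred1 north_step) Q.
move: hm hl hh; rewrite /ht /north /aone sQ => hm hl hh; rewrite hl hh.
lia.
Qed.

(* Main.v *)
Require Import Defs.
From mathcomp Require Import all_boot all_order all_algebra finmap.
From mathcomp Require Import boolp classical_sets functions cardinality fsbigop.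
From mathcomp Require Import zify ring.

(** A path of length n and height m has lost n - m units with respect to the
    path made of n north steps.

    Counting by total deficit d = n - m turns the enumeration into one about
    power series: deficits are natural numbers, they add up along a path, and
    a path stays weakly above the diagonal exactly when after i steps its
    deficit is at most i.  Let y mark north steps and x mark the steps (1, b).
    With U = u + u^2 + ..., the steps have generating function
    P = y + x U + U^2, because a step (a, b) with a >= 2 has deficit
    (a - 1) + (2 - b), a sum of two independent positive integers.

    Let G_n(u) be the generating function of the F-paths of length n.  Then
    G_(n+1) is G_n P with the terms of degree above n + 1 removed.  The claim
    that makes everything work (coef_path_gf) is that y G_n agrees with
    (P - u P') P^n up to degree n.  The right-hand side satisfies the
    recurrence without the truncation.  The truncation does not matter,
    since the only term of degree n + 1 it could feed back is
    [u^(n+1)] (P - u P') P^n, and Euler's identity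
    (n+1) (P - u P') P^n = (n+1) P^(n+1) - u (P^(n+1))'
    gives it the factor (n+1) - (n+1) = 0.  The same identity then yields
    (n+1) y [u^d] G_n = (n+1-d) [u^d] P^(n+1), which is the cycle lemma for
    these paths; here n + 1 - d = m + 1.

    Expanding the trinomial power, with [u^d] U^r the number of compositions
    of d into r parts, gives the three-parameter formula num_FpathsE:
    a_n(h,l,m) is (m+1)/(n+1) times C(n+1,l+1) C(n-l,h) C(n-m-1,2n-2l-h-1).
    The seven formulas are sums of this one.  Summing over m is a weighted
    hockey-stick identity, summing over h is Vandermonde's convolution, and
    summing over l only regroups the trinomial coefficient and reverses the
    order of summation. *)

Set Implicit Arguments.
Unset Strict Implicit.
Unset Printing Implicit Defensive.

Import Order.TTheory GRing.Theory Num.Theory.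
Local Open Scope classical_set_scope.
Local Open Scope ring_scope.

(** * Deficits *)

Definition deficit (s : int * int) : nat := `|(1 + s.1 - s.2)%R|%N.

Definition path_deficit (Q : seq (int * int)) : nat :=
  (\sum_(s <- Q) deficit s)%N.

Lemma path_deficit_rcons Q s :
  path_deficit (rcons Q s) = (path_deficit Q + deficit s)%N.
Proof. by rewrite /path_deficit -cats1 big_cat big_seq1. Qed.

Lemma Fstep_deficit s : Fstep s -> s.2 - s.1 = 1 - (deficit s)%:Z.
Proof.
case: s => a b; rewrite /Fstep /deficit /north_step /=.
by case/orP => [/andP[]|/eqP[-> ->]]; lia.
Qed.

Lemma sum_path_deficit Q : all Fstep Q ->
  (\sum_(s <- Q) s).2 - (\sum_(s <- Q) s).1 = (size Q)%:Z - (path_deficit Q)%:Z.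
Proof.
rewrite /path_deficit; elim: Q => [|s Q IH] /=; first by rewrite !big_nil.
case/andP => /Fstep_deficit st /IH; rewrite !big_cons /=; lia.
Qed.

Lemma ht_path_deficit Q : all Fstep Q ->
  ht Q = (size Q)%:Z - (path_deficit Q)%:Z.
Proof. by move=> aQ; rewrite /ht /vertex take_size sum_path_deficit. Qed.

Lemma Fpath0 Q : Fpath 0 Q <-> Q = [::].
Proof.
split=> [[/size0nil]//|->]; split=> // i; lia.
Qed.

(** Only the last vertex has to be tested when a step is appended: its height
    n + 1 minus the deficit must not be negative. *)
Lemma Fpath_rcons n Q s :
  Fpath n.+1 (rcons Q s) <->
  [/\ Fpath n Q, Fstep s & (path_deficit (rcons Q s) <= n.+1)%N].
Proof.
split=> [[]|[[sQ aQ hQ] st dQ]].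
  rewrite size_rcons all_rcons => -[sQ] /andP[st aQ] hQ.
  have aQs : all Fstep (rcons Q s) by rewrite all_rcons st.
  split=> //; last first.
    have := hQ n.+1; rewrite leqnn /vertex take_oversize ?size_rcons ?sQ//.
    move=> /(_ isT); rewrite -subr_ge0 sum_path_deficit// size_rcons sQ; lia.
  split=> // i /andP[i1 iN]; have := hQ i; rewrite /vertex.
  by rewrite -cats1 takel_cat ?sQ// i1 (leqW iN); exact.
have aQs : all Fstep (rcons Q s) by rewrite all_rcons st.
split=> //; first by rewrite size_rcons sQ.
move=> i /andP[i1]; rewrite leq_eqVlt ltnS => /orP[/eqP->|iN].
  rewrite /vertex take_oversize ?size_rcons ?sQ//.
  rewrite -subr_ge0 sum_path_deficit// size_rcons sQ; lia.
by have := hQ i; rewrite /vertex -cats1 takel_cat ?sQ// i1 iN; exact.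
Qed.

(** * Enumeration of paths *)

(** Infinitely many steps are available, but a path of length n has total
    deficit at most n, so steps of larger deficit never occur.  The cutoff is
    put on the two coordinates separately, not on the deficit, so that the
    generating function of the list is exactly y + x U + U^2 with
    U = u + ... + u^N. *)
Definition steps (N : nat) : seq (int * int) :=
  north_step :: [seq (1, 1 - k%:Z) | k <- iota 0 N]
    ++ [seq (i.+2%:Z, 1 - k%:Z) | i <- iota 0 N, k <- iota 0 N].

Lemma steps_uniq N : uniq (steps N).
Proof.
rewrite /steps /= cat_uniq mem_cat negb_or; apply/and3P; split.
- apply/andP; split; first by apply/mapP => -[k _ []].
  by apply/allpairsP => -[[i k] [_ _ []]].
- by rewrite map_inj_uniq ?iota_uniq// => i j [] /=; lia.
apply/andP; split.
  apply/hasPn => s /allpairsP[[i k] [_ _ ->]] /=.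
  by apply/mapP => -[j _ []]; lia.
apply: allpairs_uniq; rewrite ?iota_uniq// => -[i k] [i' k'] _ _ /= [] ? ?.
by congr (_, _); lia.
Qed.

Lemma mem_steps_Fstep N s : s \in steps N -> Fstep s.
Proof.
rewrite inE mem_cat => /orP[/eqP->//|/orP[/mapP[k _ ->]|]].
  by rewrite /Fstep /=; lia.
by case/allpairsP => -[i k] [_ _ ->]; rewrite /Fstep /=; lia.
Qed.

Lemma mem_steps N s : Fstep s -> (deficit s <= N)%N -> s \in steps N.
Proof.
case: s => a b; rewrite /Fstep /deficit inE mem_cat /=.
case/orP => [/andP[a1 b1] dN|->//].
have [->|an1] := eqVneq a 1.
  apply/orP; right; apply/orP; left; apply/mapP; exists `|(1 - b)%R|%N.
    by rewrite mem_iota; lia.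
  by congr (_, _); lia.
apply/orP; right; apply/orP; right; apply/allpairsP.
exists (`|(a - 2)%R|%N, `|(1 - b)%R|%N); rewrite !mem_iota /=; split; try lia.
by congr (_, _); lia.
Qed.

Fixpoint paths (N n : nat) : seq (seq (int * int)) :=
  if n is n'.+1 then
    [seq Q <- [seq rcons Q s | Q <- paths N n', s <- steps N]
       | (path_deficit Q <= n)%N]
  else [:: [::]].

Lemma paths_uniq N n : uniq (paths N n).
Proof.
elim: n => [//|n IH]; apply: filter_uniq.
apply: allpairs_uniq; rewrite ?steps_uniq//.
by move=> [Q s] [Q' s'] _ _ /= /rcons_inj.
Qed.

(** The bound n <= N guarantees that no step of a path exceeds the cutoff. *)
Lemma mem_paths N n Q : (n <= N)%N -> Q \in paths N n <-> Fpath n Q.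
Proof.
elim: n Q => [|n IH] Q nN; first by rewrite Fpath0 inE; split=> /eqP.
rewrite mem_filter; split=> [/andP[dQ /allpairsP[[Q' s] /= [Q'p sN eQ]]]|].
  move: dQ; rewrite {}eQ => dQ; apply/Fpath_rcons.
  by split=> //; [apply/IH => //; exact: ltnW|exact: mem_steps_Fstep sN].
case/lastP: Q => [[]//|Q s] /Fpath_rcons[pQ st dQ]; rewrite dQ andTb.
apply/allpairsP; exists (Q, s) => /=; split=> //.
  by apply/IH => //; exact: ltnW.
by apply: mem_steps => //; move: dQ; rewrite path_deficit_rcons; lia.
Qed.

(** * Generating functions *)

(** Compositions of d into r positive parts.  The last factor deals with the
    predecessor of 0: there is one composition of 0 into no part, none of a
    positive d into no part and none of 0 into r > 0 parts. *)
Definition num_compositions (d r : nat) : nat :=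
  ('C(d.-1, r.-1) * ((d == 0) == (r == 0)))%N.

Section GeneratingFunctions.
Variables (A : comNzRingType) (x y : A) (N : nat).

Definition geom : {poly A} := \sum_(k <- iota 0 N) 'X^(k.+1).

Definition step_gf : {poly A} := y%:P + x *: geom + geom ^+ 2.

Definition weight (s : int * int) : A :=
  y ^+ (s == north_step) * x ^+ (s.1 == 1).

Definition path_gf (n : nat) : {poly A} :=
  \sum_(Q <- paths N n) (y ^+ north Q * x ^+ aone Q) *: 'X^(path_deficit Q).

Lemma step_gfE : step_gf = \sum_(s <- steps N) weight s *: 'X^(deficit s).
Proof.
rewrite /steps big_cons big_cat /= big_map big_allpairs_dep /= /step_gf addrA.
congr (_ + _ + _).
- by rewrite /weight /= mulr1 expr1 alg_polyC.
- rewrite /geom scaler_sumr; apply: eq_bigr => k _.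
  have -> : deficit (1, 1 - k%:Z) = k.+1 by rewrite /deficit /=; lia.
  by rewrite /weight /= mul1r expr1.
rewrite expr2 mulr_suml; apply: eq_bigr => i _.
rewrite mulr_sumr; apply: eq_bigr => k _.
have -> : deficit (i.+2%:Z, 1 - k%:Z) = (i.+1 + k.+1)%N.
  by rewrite /deficit /=; lia.
by rewrite /weight /= mul1r expr0 scale1r exprD.
Qed.

Lemma coef_path_gfS n d :
  (path_gf n.+1)`_d = if (d <= n.+1)%N then (path_gf n * step_gf)`_d else 0.
Proof.
have -> : path_gf n * step_gf = \sum_(Q <- [seq rcons Q s | Q <- paths N n, s <- steps N])
    (y ^+ north Q * x ^+ aone Q) *: 'X^(path_deficit Q).
  rewrite big_allpairs_dep /= /path_gf mulr_suml; apply: eq_bigr => Q _.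
  rewrite step_gfE mulr_sumr; apply: eq_bigr => s _.
  rewrite path_deficit_rcons /north /aone -!cats1 !count_cat /= !addn0.
  rewrite !exprD -scalerAl -scalerAr scalerA /weight; congr (_ *: _).
  by rewrite mulrACA.
rewrite /path_gf /= big_filter !coef_sum big_mkcond /=.
case: ifPn => dn; [apply: eq_bigr|apply: big1] => Q _.
  case: ifPn => // Qn; rewrite coefZ coefXn [d == _]ltn_eqF ?mulr0//; lia.
case: ifPn => // Qn; rewrite coefZ coefXn [d == _]gtn_eqF ?mulr0//; lia.
Qed.

Lemma coef_path_gf_gt n d : (n < d)%N -> (path_gf n)`_d = 0.
Proof.
case: n => [|n] nd; last by rewrite coef_path_gfS leqNgt nd.
by rewrite /path_gf /= big_seq1 coefZ /path_deficit big_nil coefXn gtn_eqF ?mulr0.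
Qed.

(** Multiplication by the index d is the operator u d/du, and
    u (p^(n+1))' = (n+1) u p' p^n. *)
Lemma coef_euler (p : {poly A}) n d :
  ((p - 'X * p^`()) * p ^+ n)`_d *+ n.+1 + (p ^+ n.+1)`_d *+ d
  = (p ^+ n.+1)`_d *+ n.+1.
Proof.
have -> : (p ^+ n.+1)`_d *+ d = ('X * (p ^+ n.+1)^`())`_d.
  by rewrite coefXM coef_deriv; case: d => [|d].
rewrite deriv_exp /= -!coefMn -coefD; congr (_`_d).
rewrite mulrnAr -mulrnDl exprS; set D := p^`().
by have -> : (p - 'X * D) * p ^+ n + 'X * (D * p ^+ n) = p * p ^+ n by ring.
Qed.

(** Induction on the length: both sides are multiplied by P, and the recurrence
    for paths sees the previous path series only up to degree n.  For d = n + 1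
    the product on the right also involves the coefficient of degree n + 1,
    which vanishes by coef_euler; dividing by n + 1 there is the reason for the
    torsion hypothesis. *)
Lemma coef_path_gf n d :
  (forall (a : A) k, a *+ k.+1 = 0 -> a = 0) -> (d <= n)%N ->
  y * (path_gf n)`_d = ((step_gf - 'X * step_gf^`()) * step_gf ^+ n)`_d.
Proof.
move=> charA0; set E := step_gf - _.
elim: n d => [|n IH] d dn.
  move: dn; rewrite leqn0 => /eqP->.
  rewrite expr0 mulr1 coefB coefXM subr0 /path_gf big_seq1 /path_deficit.
  rewrite big_nil coefZ coefXn !mulr1 /step_gf !coefD coefC coefZ expr2 coefM.
  by rewrite big_ord1 /geom coef_sum big1 ?mulr0 ?addr0// => k _; rewrite coefXn.
rewrite coef_path_gfS dn exprSr mulrA !coefM mulr_sumr.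
apply: eq_bigr => i _; rewrite mulrA; congr (_ * _).
have [iN|nI] := leqP i n; first exact: IH.
(* The term outside the range of the induction hypothesis. *)
have -> : nat_of_ord i = n.+1 by have := ltn_ord i; lia.
rewrite coef_path_gf_gt// mulr0; apply/esym/(charA0 _ n).
exact: (addIr _ (etrans (coef_euler _ _ _) (esym (add0r _)))).
Qed.

(** U = u + u U - u^(N+1) turns into Pascal's rule for the coefficients of the
    powers of U, as long as the degree does not reach N + 1. *)
Lemma coef_geom_exp r d : (d <= N)%N ->
  (geom ^+ r)`_d = (num_compositions d r)%:R.
Proof.
rewrite /num_compositions.
have geomX : geom = 'X + geom * 'X - 'X^N * 'X.
  rewrite /geom; elim: N => [|k IH]; first by rewrite !big_nil expr0; ring.
  rewrite -{1 2}addn1 iotaD !big_cat !big_seq1 /= {1}IH exprS.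
  set S := \sum_(i <- _) _; ring.
elim: r d => [|r IH] d dN; first by rewrite expr0 coef1 bin0; case: d dN.
elim: d dN => [|d IHd] dN.
  rewrite exprSr [X in (_ * X)]geomX !mulrDr mulrA mulrN !mulrA coefB coefD !coefMX.
  by rewrite subr0 addr0 muln0.
rewrite exprSr [X in (_ * X)]geomX !mulrDr mulrA mulrN !mulrA coefB coefD !coefMX /=.
rewrite coefMXn dN subr0 -exprSr IH ?IHd// 1?ltnW// -natrD.
congr (_%:R); case: d {IHd dN} => [|d]; case: r {IH} => [|r] //=;
  rewrite ?muln0 ?muln1 ?addn0 ?add0n ?bin0 ?bin0n// binS addnC//.
Qed.

Lemma coef_step_gf_exp n d : (d <= N)%N ->
  (step_gf ^+ n)`_d =
  \sum_(i < n.+1) \sum_(k < (n - i).+1)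
    y ^+ i * x ^+ k * ('C(n, i) * 'C(n - i, k)
      * num_compositions d (2 * (n - i) - k))%:R.
Proof.
move=> dN; rewrite /step_gf -addrA addrC exprDn coef_sum; apply: eq_bigr => i _.
rewrite addrC exprDn mulr_suml -sumrMnl coef_sum; apply: eq_bigr => k _.
rewrite mulrnAl -exprM exprZn -scalerAr -exprD -polyC_exp -mulrC mul_polyC.
rewrite !coefMn !coefZ.
have -> : (2 * (n - i - k) + k = 2 * (n - i) - k)%N by have := ltn_ord k; lia.
rewrite (coef_geom_exp _ dN) -[_ *+ 'C(n, i)]mulr_natr.
rewrite -[_ *+ 'C(n - i, k)]mulr_natr !natrM.
move: ('C(n, i)%:R : A) ('C(n - i, k)%:R : A) (_%:R : A) => a b c.
by ring.
Qed.

End GeneratingFunctions.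

(** * The number of paths with all three statistics fixed *)

Section Counting.
Local Notation bivar := {poly {poly rat}}.
Local Notation x := ('X%:P : bivar).
Local Notation y := ('X : bivar).

Lemma coef_coef_monomial (i k h l : nat) (c : nat) :
  (y ^+ i * x ^+ k * c%:R)`_l`_h = (c * ((l == i) && (h == k)))%:R.
Proof.
rewrite mulr_natr !coefMn mulrC -polyC_exp coefCM coefXn mulr_natr coefMn coefXn.
by rewrite -!mulrnA; case: (l == i); case: (h == k); rewrite ?mul1n ?muln1 ?muln0 ?mul0n.
Qed.

Lemma num_Fpaths_count n h l m : (m <= n)%N ->
  num_Fpaths n h l m =
  count (fun Q => [&& path_deficit Q == (n - m)%N, north Q == l & aone Q == h])
    (paths n n).
Proof.
move=> mn; set p := (X in count X).
rewrite -size_filter -(undup_id (filter_uniq p (paths_uniq n n))) -card_fseq.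
congr #|` _|; apply/fsetP => Q.
rewrite in_fset_set; last exact: finite_Fpaths.
rewrite inE mem_filter /p; apply/idP/idP => [|/andP[/and3P[/eqP dQ /eqP nQ /eqP aQ]]].
  rewrite inE => -[pQ hQ nQ aQ]; rewrite nQ aQ !eqxx !andbT.
  rewrite (_ : (Q \in paths n n)) ?andbT; last exact/mem_paths.
  by have [sQ aFQ _] := pQ; move: hQ; rewrite ht_path_deficit// sQ; lia.
move=> /mem_paths => /(_ (leqnn n)) pQ; rewrite inE; split=> //.
by have [sQ aFQ _] := pQ; rewrite ht_path_deficit// sQ dQ; lia.
Qed.

Lemma coef_path_gf_count n h l d :
  (path_gf x y n n)`_d`_l`_h =
  (count (fun Q => [&& path_deficit Q == d, north Q == l & aone Q == h])
    (paths n n))%:R.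
Proof.
rewrite /path_gf !coef_sum -sum1_count natr_sum [RHS]big_mkcond /=.
apply: eq_bigr => Q _; rewrite coefZ coefXn [d == _]eq_sym.
case: eqP => _; last by rewrite mulr0 !coef0.
have := coef_coef_monomial (north Q) (aone Q) h l 1.
rewrite !mulr1 mul1n => -> /=.
by rewrite [l == _]eq_sym [h == _]eq_sym; case: ifP.
Qed.

(** Coefficient of u^(n-m) y^(l+1) x^h in
    (n+1) y G_n = (n+1) P^(n+1) - u (P^(n+1))'.  One extra north step appears
    because of the factor y. *)
Lemma muln_num_Fpaths n h l m : (l <= n)%N -> (m <= n)%N ->
  ((n.+1 * num_Fpaths n h l m) =
   m.+1 * ('C(n.+1, l.+1) * 'C(n - l, h) * num_compositions (n - m) (2 * (n - l) - h)))%N.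
Proof.
move=> ln mn; apply/eqP; rewrite -(eqr_nat rat); apply/eqP.
have A0 (a : bivar) k : a *+ k.+1 = 0 -> a = 0.
  move=> ak; apply/polyP => i; apply/polyP => j.
  have := congr1 (fun p : bivar => p`_i`_j) ak.
  by rewrite !coefMn !coef0 => /eqP; rewrite mulrn_eq0 => /eqP.
have yG : (y * (path_gf x y n n)`_(n - m))`_l.+1`_h = (num_Fpaths n h l m)%:R :> rat.
  by rewrite mulrC coefMX /= coef_path_gf_count num_Fpaths_count.
have S : (step_gf x y n ^+ n.+1)`_(n - m)`_l.+1`_h
    = ('C(n.+1, l.+1) * 'C(n.+1 - l.+1, h)
       * num_compositions (n - m) (2 * (n.+1 - l.+1) - h))%:R :> rat.
  have ln1 : (l.+1 < n.+2)%N by [].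
  rewrite coef_step_gf_exp ?leq_subr// !coef_sum.
  rewrite (bigD1 (Ordinal ln1)) //= [X in _ + X]big1 ?addr0; last first.
    move=> i il; rewrite !coef_sum big1// => k _.
    rewrite coef_coef_monomial (_ : (l.+1 == i) = false) ?muln0//.
    by apply: contraNF il => /eqP hk; apply/eqP/val_inj.
  have [hk1|hk1] := leqP (n.+1 - l.+1).+1 h.
    rewrite (bin_small hk1) muln0 mul0n !coef_sum big1// => k _.
    rewrite coef_coef_monomial (_ : (h == k) = false) ?andbF ?muln0//.
    by rewrite gtn_eqF// (leq_trans _ hk1).
  rewrite !coef_sum (bigD1 (Ordinal hk1)) //= [X in _ + X]big1 ?addr0; last first.
    move=> k kh; rewrite coef_coef_monomial eqxx (_ : (h == k) = false) ?muln0//.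
    by apply: contraNF kh => /eqP hk; apply/eqP/val_inj.
  by rewrite coef_coef_monomial !eqxx muln1.
have := congr1 (fun p : bivar => p`_l.+1`_h) (coef_euler (step_gf x y n) n (n - m)).
rewrite -coef_path_gf ?leq_subr// !coefD !coefMn yG S subSS.
move=> /eqP; rewrite -!mulrnA -natrD eqr_nat => /eqP.
set c := (_ * num_compositions _ _)%N => E; congr (_%:R); nia.
Qed.

End Counting.

(** * Binomial coefficients with integer arguments *)

Lemma binz_nat (p q : nat) : binz p%:Z q%:Z = 'C(p, q)%:R.
Proof.
rewrite /binz /=; case: ifPn => //; rewrite lez_nat => pq.
by rewrite bin_small// ltnNge.
Qed.

Lemma binz_negr (p q : int) : q < 0 -> 0 <= p -> binz p q = 0.
Proof.
move=> q0 p0; rewrite /binz leNgt q0 /=.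
by rewrite (_ : (p == -1) = false)//; lia.
Qed.

Lemma binz_negl (p q : int) : p < -1 -> binz p q = 0.
Proof.
move=> p1; rewrite /binz (_ : (0 <= q <= p) = false); last lia.
by rewrite (_ : (p == -1) = false)//; lia.
Qed.

(** For p = -1 the rule fails at q = -2, where C(-1,-1) appears on the right
    and C(0,-1) = 0 on the left. *)
Lemma binz_pascal (p : nat) (q : int) :
  binz (p%:Z + 1) (q + 1) = binz p%:Z (q + 1) + binz p%:Z q.
Proof.
have [q0|q0] := leP 0 q.
  have -> : q = `|q|%N%:Z by lia.
  by rewrite -!PoszD !addn1 !binz_nat binS natrD.
have [->|q1] := eqVneq q (-1).
  rewrite addNr (binz_negr (q := -1))// -PoszD -[0]/(0%N%:Z) !binz_nat.
  by rewrite !bin0 addr0.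
by rewrite !binz_negr ?addr0//; lia.
Qed.

(** The convention that C(-1,-1) is 1 accounts for the empty composition. *)
Lemma binz_num_compositions (d r : nat) :
  binz (d%:Z - 1) (r%:Z - 1) = (num_compositions d r)%:R.
Proof.
rewrite /num_compositions; case: d => [|d]; case: r => [|r] /=.
- by rewrite bin0.
- by rewrite muln0 binz_eq0//; lia.
- by rewrite muln0 binz_negr//; lia.
have -> : d.+1%:Z - 1 = d%:Z by lia.
have -> : r.+1%:Z - 1 = r%:Z by lia.
by rewrite binz_nat muln1.
Qed.

Lemma num_FpathsE n h l m :
  (num_Fpaths n h l m)%:R = (m%:R + 1) / (n%:R + 1)
    * binz (n%:Z + 1) (l%:Z + 1) * binz (n%:Z - l%:Z) h%:Z
    * binz (n%:Z - m%:Z - 1) (2 * n%:Z - 2 * l%:Z - h%:Z - 1).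
Proof.
have [nl|ln] := ltnP n l.
  rewrite num_Fpaths_eq0 ?nl ?orbT// (binz_eq0 (p := n%:Z + 1)) ?mulr0 ?mul0r//; lia.
have [nm|mn] := ltnP n m.
  rewrite num_Fpaths_eq0 ?nm ?orbT// (binz_negl (p := n%:Z - _ - 1)) ?mulr0//; lia.
have n0 : n%:R + 1 != 0 :> rat by rewrite natr1 pnatr_eq0.
apply: (mulfI n0); rewrite {1}natr1 -natrM muln_num_Fpaths//.
rewrite -!PoszD !addn1 binz_nat subzn// binz_nat.
have [hl|hl] := ltnP (n - l) h.
  by rewrite (bin_small hl) muln0 mul0n muln0 !(mulr0, mul0r).
have -> : 2 * n%:Z - 2 * l%:Z - h%:Z - 1 = (2 * (n - l) - h)%N%:Z - 1 by lia.
rewrite subzn// binz_num_compositions !natrM -natr1; field; exact: n0.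
Qed.

(** The term m = N is C(-1,q), which contributes 1 for q = -1 and makes the
    identity valid there too. *)
Lemma hockey_stick (N : nat) (q : int) : -1 <= q ->
  \sum_(m < N.+1) binz (N%:Z - m%:Z - 1) q = binz N%:Z (q + 1).
Proof.
move=> q1; elim: N => [|N IH].
  rewrite big_ord1 subrr sub0r.
  have [->//|qn] := eqVneq q (-1).
  by rewrite (binz_eq0 (p := -1)) ?(binz_eq0 (p := 0))//; lia.
rewrite big_ord_recl (eq_bigr (fun m : 'I_N.+1 => binz (N%:Z - m%:Z - 1) q)).
  by rewrite IH addrC -addn1 PoszD binz_pascal subr0 addrK.
by move=> m _; congr binz; rewrite /= /bump; lia.
Qed.

(** Writing m + 1 as 1 + m splits the sum for N + 1 into a plain hockey stick
    and the weighted sum for N. *)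
Lemma weighted_hockey_stick (N : nat) (q : int) : -1 <= q ->
  \sum_(m < N.+1) (m%:R + 1) * binz (N%:Z - m%:Z - 1) q = binz (N%:Z + 1) (q + 2).
Proof.
move=> q1; elim: N => [|N IH].
  have := hockey_stick 0 q1; rewrite !big_ord1 add0r mul1r => ->.
  rewrite (_ : q + 2 = q + 1 + 1); last lia.
  by rewrite binz_pascal (binz_eq0 (q := q + 1 + 1)) ?add0r//; lia.
under eq_bigr do rewrite mulrDl mul1r.
rewrite big_split /= (hockey_stick _ q1) big_ord_recl mul0r add0r.
rewrite (eq_bigr (fun m : 'I_N.+1 => (m%:R + 1) * binz (N%:Z - m%:Z - 1) q)).
  rewrite IH (_ : q + 2 = q + 1 + 1); last lia.
  by rewrite (binz_pascal N.+1) (_ : N%:Z + 1 = N.+1%:Z) 1?addrC//; lia.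
move=> m _; rewrite /= /bump /= add1n -natr1; congr (_ * binz _ _); lia.
Qed.

Lemma fsum_nat (F : nat -> rat) (K : nat) :
  (forall i, (K <= i)%N -> F i = 0) ->
  \sum_(i \in [set: nat]) F i = \sum_(i < K) F i.
Proof.
move=> F0; rewrite fsbig_ord.
apply/esym/fsbig_widen => // i [_] /= /negP; rewrite -leqNgt; exact: F0.
Qed.

Lemma binz_sym (p : nat) (q : int) : binz p%:Z q = binz p%:Z (p%:Z - q).
Proof.
have [q0|q0] := ltP q 0; first by rewrite binz_negr ?binz_eq0//; lia.
have [pq|qp] := ltP p%:Z q; first by rewrite binz_eq0 ?binz_negr//; lia.
have -> : q = `|q|%N%:Z by lia.
rewrite subzn; last lia.
by rewrite !binz_nat bin_sub//; lia.
Qed.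

(** Both sides are the trinomial coefficient p! / (a! b! (p-a-b)!) when a + b <= p,
    and vanish otherwise. *)
Lemma bin_trinomial (p a b : nat) :
  ('C(p, a) * 'C(p - a, b) = 'C(p, b) * 'C(p - b, a))%N.
Proof.
have [pab|abp] := ltnP p (a + b).
  have [pa|ap] := ltnP p a.
    have pba : (p - b < a)%N by lia.
    by rewrite (bin_small pa) (bin_small pba) muln0.
  have pab' : (p - a < b)%N by lia.
  have [pb|bp] := ltnP p b; first by rewrite (bin_small pb) (bin_small pab') muln0.
  have pba : (p - b < a)%N by lia.
  by rewrite (bin_small pab') (bin_small pba) !muln0.
have fact_expand c d : (c + d <= p)%N ->
    ('C(p, c) * 'C(p - c, d) * (c`! * d`! * (p - (c + d))`!) = p`!)%N.
  move=> cdp; have cp : (c <= p)%N by lia.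
  have dp : (d <= p - c)%N by lia.
  rewrite -(bin_fact cp) -(bin_fact dp) -subnDA; ring.
have F0 : (0 < a`! * b`! * (p - (a + b))`!)%N by rewrite !muln_gt0 !fact_gt0.
apply/eqP; rewrite -(eqn_pmul2r F0) fact_expand//.
by rewrite [(a`! * b`!)%N]mulnC [(a + b)%N]addnC fact_expand// addnC.
Qed.

Lemma binz_trinomial (n l h : nat) : (l <= n)%N ->
  binz (n%:Z + 1) (l%:Z + 1) * binz (n%:Z - l%:Z) h%:Z
  = binz (n%:Z + 1) h%:Z * binz (n%:Z - h%:Z + 1) (l%:Z + 1).
Proof.
move=> ln; rewrite -!PoszD !addn1 subzn//.
have [nh|hn] := ltnP n h.
  rewrite (@binz_eq0 (n - l)%N) ?mulr0; try lia.
  by rewrite [X in _ * X]binz_eq0 ?mulr0//; lia.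
have -> : n%:Z - h%:Z + 1 = (n.+1 - h)%N%:Z by lia.
by rewrite !binz_nat -!natrM -bin_trinomial subSS.
Qed.

Lemma binz_Vandermonde (a b K : nat) (q : int) : (a < K)%N ->
  \sum_(h < K) binz a%:Z h%:Z * binz b%:Z (q - h%:Z) = binz (a + b)%N%:Z q.
Proof.
move=> aK; have [q0|q0] := ltP q 0.
  by rewrite [RHS]binz_negr// big1// => h _; rewrite (binz_negr (p := b)) ?mulr0//; lia.
case: q q0 => // r _; pose F (h : nat) := binz a%:Z h%:Z * binz b%:Z (r%:Z - h%:Z).
rewrite -(fsum_nat (F := F)) => [|i Ki]; last first.
  by rewrite /F binz_eq0 ?mul0r//; lia.
rewrite (fsum_nat (K := r.+1)) => [|i Ki]; last first.
  by rewrite /F (binz_negr (p := b)) ?mulr0//; lia.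
rewrite binz_nat -binomial.Vandermonde natr_sum; apply: eq_bigr => h _.
have hr : (h <= r)%N by rewrite -ltnS.
by rewrite /F natrM subzn// !binz_nat.
Qed.

(** * Sums of the three-parameter formula *)

Lemma sum_over_ht n h l :
  \sum_(m < n.+1) (num_Fpaths n h l m)%:R
  = 1 / (n%:R + 1) * binz (n%:Z + 1) (l%:Z + 1) * binz (n%:Z - l%:Z) h%:Z
    * binz (n%:Z + 1) (2 * l%:Z + h%:Z - n%:Z) :> rat.
Proof.
under eq_bigr do rewrite num_FpathsE.
have [nl|ln] := ltnP n l.
  rewrite (binz_eq0 (p := n%:Z + 1) (q := l%:Z + 1)) ?mulr0 ?mul0r; try lia.
  by rewrite big1// => m _; rewrite mulr0 !mul0r.
rewrite subzn//; have [hl|hl] := ltnP (n - l) h.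
  rewrite (binz_nat _ h) bin_small// mulr0 mul0r big1// => m _.
  by rewrite mulr0 mul0r.
rewrite (_ : binz _ (2 * _ + _ - _)
          = binz (n%:Z + 1) (2 * n%:Z - 2 * l%:Z - h%:Z - 1 + 2)); last first.
  have -> : n%:Z + 1 = n.+1%:Z by lia.
  by rewrite binz_sym; congr binz; lia.
rewrite -weighted_hockey_stick; last lia.
by rewrite mulr_sumr; apply: eq_bigr => m _; ring.
Qed.

(** Vandermonde's convolution applies when m < n.  For m >= n the upper argument
    n - m - 1 is negative, and both sides vanish unless m = n = l. *)
Lemma sum_over_aone n l m :
  \sum_(h < n.+1) (num_Fpaths n h l m)%:R
  = (m%:R + 1) / (n%:R + 1) * binz (n%:Z + 1) (l%:Z + 1)
    * binz (2 * n%:Z - l%:Z - m%:Z - 1) (2 * n%:Z - 2 * l%:Z - 1) :> rat.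
Proof.
under eq_bigr do rewrite num_FpathsE -mulrA.
rewrite -mulr_sumr.
have [nl|ln] := ltnP n l.
  by rewrite (binz_eq0 (p := n%:Z + 1)) ?mulr0 ?mul0r//; lia.
congr (_ * _).
rewrite subzn//; set c := (n - l)%N.
have [nm|mn] := leqP n m; last first.
  have -> : n%:Z - m%:Z - 1 = (n - m.+1)%N%:Z by lia.
  have -> : 2 * n%:Z - l%:Z - m%:Z - 1 = (c + (n - m.+1))%N%:Z by lia.
  rewrite -(binz_Vandermonde _ _ (K := n.+1)); last lia.
  by apply: eq_bigr => h _; congr (_ * binz _ _); lia.
have [c0|c1] := posnP c.
  rewrite c0 big_ord_recl big1 => [|h _]; last first.
    by rewrite binz_eq0 ?mul0r.
  by rewrite addr0 binz_nat bin0 mul1r /=; congr binz; lia.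
rewrite (binz_eq0 (q := 2 * _ - _ - _)); try lia.
rewrite big1// => h _; have [hc|ch] := leqP h c.
  by rewrite (binz_eq0 (p := n%:Z - _ - _)) ?mulr0//; lia.
by rewrite binz_eq0 ?mul0r//; lia.
Qed.

(** After the summation over heights, C(n+1, 2l+h-n) equals
    C(n+1, 2(n-l)+1-h), so that the sum over h is a Vandermonde convolution. *)
Lemma sum_over_ht_aone n l :
  \sum_(h < n.+1) \sum_(m < n.+1) (num_Fpaths n h l m)%:R
  = 1 / (n%:R + 1) * binz (n%:Z + 1) (l%:Z + 1)
    * binz (2 * n%:Z - l%:Z + 1) l%:Z :> rat.
Proof.
under eq_bigr do rewrite sum_over_ht -mulrA.
rewrite -mulr_sumr; have [nl|ln] := ltnP n l.
  by rewrite (binz_eq0 (p := n%:Z + 1)) ?mulr0 ?mul0r//; lia.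
congr (_ * _).
have -> : 2 * n%:Z - l%:Z + 1 = (n - l + n.+1)%N%:Z by lia.
rewrite binz_sym -(binz_Vandermonde _ _ (K := n.+1)); last lia.
apply: eq_bigr => h _; rewrite subzn//; congr (_ * _).
have -> : n%:Z + 1 = n.+1%:Z by lia.
by rewrite binz_sym; congr binz; lia.
Qed.

(** The substitution i = n - h - l exchanges the two forms of the sum. *)
Lemma sum_over_ht_north n h :
  \sum_(l < n.+1) \sum_(m < n.+1) (num_Fpaths n h l m)%:R
  = 1 / (n%:R + 1) * binz (n%:Z + 1) h%:Z
    * \sum_(i < n.+1) (binz (n%:Z - h%:Z + 1) i%:Z
                       * binz (n%:Z + 1) (2 * i%:Z + h%:Z + 1)) :> rat.
Proof.
pose F (l : nat) := binz (n%:Z - h%:Z + 1) (l%:Z + 1)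
  * binz (n%:Z + 1) (2 * l%:Z + h%:Z - n%:Z).
pose G (i : nat) := binz (n%:Z - h%:Z + 1) i%:Z
  * binz (n%:Z + 1) (2 * i%:Z + h%:Z + 1).
rewrite (eq_bigr (fun l : 'I_n.+1 => 1 / (n%:R + 1) * binz (n%:Z + 1) h%:Z * F l)).
  rewrite -mulr_sumr; congr (_ * _).
  have [nh|hn] := ltnP n h.
    rewrite big1 => [|i _]; last by rewrite /F binz_eq0 ?mul0r//; lia.
    by rewrite big1// => i _; rewrite (@binz_eq0 (n%:Z + 1)) ?mulr0//; lia.
  rewrite -(fsum_nat (F := F)) => [|i ni]; last first.
    by rewrite /F binz_eq0 ?mul0r//; lia.
  rewrite -(fsum_nat (F := G)) => [|i ni]; last first.
    by rewrite /G [X in _ * X]binz_eq0 ?mulr0//; lia.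
  rewrite (fsum_nat (F := F) (K := (n - h).+1)) => [|i ni]; last first.
    by rewrite /F binz_eq0 ?mul0r//; lia.
  rewrite (fsum_nat (F := G) (K := (n - h).+1)) => [|i ni]; last first.
    by rewrite /G [X in _ * X]binz_eq0 ?mulr0//; lia.
  rewrite (reindex_inj rev_ord_inj); apply: eq_bigr => i _; have := ltn_ord i.
  rewrite /F /G /= subSS ltnS => ih.
  have -> : n%:Z + 1 = n.+1%:Z by lia.
  have -> : n%:Z - h%:Z + 1 = (n.+1 - h)%N%:Z by lia.
  rewrite binz_sym [X in _ * X]binz_sym.
  by congr (binz _ _ * binz _ _); lia.
move=> l _; rewrite sum_over_ht /F mulrA; congr (_ * _).
by rewrite -mulrA binz_trinomial ?mulrA// -ltnS.
Qed.

Lemma sum_over_north n h m :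
  \sum_(l < n.+1) (num_Fpaths n h l m)%:R
  = (m%:R + 1) / (n%:R + 1) * binz (n%:Z + 1) h%:Z
    * \sum_(i < n.+1)
        (binz (n%:Z - h%:Z + 1) (i%:Z + 1)
         * binz (n%:Z - m%:Z - 1) (2 * n%:Z - h%:Z - 2 * i%:Z - 1)) :> rat.
Proof.
rewrite mulr_sumr; apply: eq_bigr => l _; rewrite num_FpathsE mulrA.
rewrite -[_ / _ * binz _ _ * binz _ _]mulrA binz_trinomial ?mulrA; last by rewrite -ltnS.
by congr (_ * binz _ _); lia.
Qed.

(** The substitution i = n - l in the formula for the sum over h. *)
Lemma sum_over_aone_north n m :
  \sum_(h < n.+1) \sum_(l < n.+1) (num_Fpaths n h l m)%:R
  = (m%:R + 1) / (n%:R + 1)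
    * \sum_(i < n.+1) (binz (n%:Z + 1) i%:Z
                       * binz (n%:Z - m%:Z + i%:Z - 1) (2 * i%:Z - 1)) :> rat.
Proof.
rewrite exchange_big /= (reindex_inj rev_ord_inj) mulr_sumr.
apply: eq_bigr => i _; rewrite sum_over_aone -mulrA; have := ltn_ord i.
rewrite /= !subSS ltnS => iN; congr (_ * (_ * _)); last first.
  by congr binz; lia.
have -> : n%:Z + 1 = n.+1%:Z by lia.
have -> : (n - i)%N%:Z + 1 = (n.+1 - i)%N%:Z by lia.
by rewrite !binz_nat bin_sub// ltnW.
Qed.

Theorem corollary6p3 (h l m n : nat) :
  [/\ \sum_(m' \in [set: nat]) ((num_Fpaths n h l m')%:R : rat)
      = 1 / (n%:R + 1) * binz (n%:Z + 1) (l%:Z + 1) * binz (n%:Z - l%:Z) h%:Z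
        * binz (n%:Z + 1) (2 * l%:Z + h%:Z - n%:Z),
      \sum_(l' \in [set: nat]) ((num_Fpaths n h l' m)%:R : rat)
      = (m%:R + 1) / (n%:R + 1) * binz (n%:Z + 1) h%:Z
        * \sum_(i \in [set: nat])
            (binz (n%:Z - h%:Z + 1) (i%:Z + 1)
             * binz (n%:Z - m%:Z - 1) (2 * n%:Z - h%:Z - 2 * i%:Z - 1)),
      \sum_(h' \in [set: nat]) ((num_Fpaths n h' l m)%:R : rat)
      = (m%:R + 1) / (n%:R + 1) * binz (n%:Z + 1) (l%:Z + 1)
        * binz (2 * n%:Z - l%:Z - m%:Z - 1) (2 * n%:Z - 2 * l%:Z - 1)
    & [/\ \sum_(l' \in [set: nat]) \sum_(m' \in [set: nat])
            ((num_Fpaths n h l' m')%:R : rat)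
          = 1 / (n%:R + 1) * binz (n%:Z + 1) h%:Z
            * \sum_(i \in [set: nat])
                (binz (n%:Z - h%:Z + 1) i%:Z
                 * binz (n%:Z + 1) (2 * i%:Z + h%:Z + 1)),
          \sum_(h' \in [set: nat]) \sum_(m' \in [set: nat])
            ((num_Fpaths n h' l m')%:R : rat)
          = 1 / (n%:R + 1) * binz (n%:Z + 1) (l%:Z + 1)
            * binz (2 * n%:Z - l%:Z + 1) l%:Z,
          \sum_(h' \in [set: nat]) \sum_(l' \in [set: nat])
            ((num_Fpaths n h' l' m)%:R : rat)
          = (m%:R + 1) / (n%:R + 1)
            * \sum_(i \in [set: nat])
                (binz (n%:Z + 1) i%:Z
                 * binz (n%:Z - m%:Z + i%:Z - 1) (2 * i%:Z - 1))
        & \sum_(h' \in [set: nat]) \sum_(l' \in [set: nat])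
            \sum_(m' \in [set: nat]) ((num_Fpaths n h' l' m')%:R : rat)
          = 1 / (n%:R + 1)
            * \sum_(i \in [set: nat])
                (binz (n%:Z + 1) (i%:Z + 1)
                 * binz (2 * n%:Z - i%:Z + 1) i%:Z)]].

Proof.
have num0 := num_Fpaths_eq0.
have sum_h l' m' : \sum_(h' \in [set: nat]) ((num_Fpaths n h' l' m')%:R : rat)
    = \sum_(h' < n.+1) (num_Fpaths n h' l' m')%:R.
  by apply: fsum_nat => i ni; rewrite num0// ni.
have sum_l h' m' : \sum_(l' \in [set: nat]) ((num_Fpaths n h' l' m')%:R : rat)
    = \sum_(l' < n.+1) (num_Fpaths n h' l' m')%:R.
  by apply: fsum_nat => i ni; rewrite num0// ni ?orbT.
have sum_m h' l' : \sum_(m' \in [set: nat]) ((num_Fpaths n h' l' m')%:R : rat)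
    = \sum_(m' < n.+1) (num_Fpaths n h' l' m')%:R.
  by apply: fsum_nat => i ni; rewrite num0// ni ?orbT.
have sum_lm h' :
    \sum_(l' \in [set: nat]) \sum_(m' \in [set: nat]) ((num_Fpaths n h' l' m')%:R : rat)
    = \sum_(l' < n.+1) \sum_(m' < n.+1) (num_Fpaths n h' l' m')%:R.
  under eq_fsbigr do rewrite sum_m.
  by apply: fsum_nat => i ni; rewrite big1// => j _; rewrite num0// ni ?orbT.
have sum_hm l' :
    \sum_(h' \in [set: nat]) \sum_(m' \in [set: nat]) ((num_Fpaths n h' l' m')%:R : rat)
    = \sum_(h' < n.+1) \sum_(m' < n.+1) (num_Fpaths n h' l' m')%:R.
  under eq_fsbigr do rewrite sum_m.
  by apply: fsum_nat => i ni; rewrite big1// => j _; rewrite num0// ni ?orbT.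
have sum_hl m' :
    \sum_(h' \in [set: nat]) \sum_(l' \in [set: nat]) ((num_Fpaths n h' l' m')%:R : rat)
    = \sum_(h' < n.+1) \sum_(l' < n.+1) (num_Fpaths n h' l' m')%:R.
  under eq_fsbigr do rewrite sum_l.
  by apply: fsum_nat => i ni; rewrite big1// => j _; rewrite num0// ni ?orbT.
split; [| | |split].
- by rewrite sum_m sum_over_ht.
- rewrite sum_l sum_over_north (fsum_nat (K := n.+1))// => i ni.
  by rewrite binz_eq0 ?mul0r//; lia.
- by rewrite sum_h sum_over_aone.
- rewrite sum_lm sum_over_ht_north (fsum_nat (K := n.+1))// => i ni.
  by rewrite (binz_eq0 (p := n%:Z + 1)) ?mulr0//; lia.
- by rewrite sum_hm sum_over_ht_aone.
- rewrite sum_hl sum_over_aone_north (fsum_nat (K := n.+1))// => i ni.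
  by rewrite (binz_eq0 (p := n%:Z - _ + _ - 1)) ?mulr0//; lia.
under eq_fsbigr do rewrite sum_lm.
rewrite (fsum_nat (K := n.+1)); last first.
  by move=> i ni; rewrite big1// => j _; rewrite big1// => k _; rewrite num0// ni.
rewrite (fsum_nat (K := n.+1)); last first.
  by move=> i ni; rewrite binz_eq0 ?mul0r//; lia.
rewrite exchange_big mulr_sumr; apply: eq_bigr => l' _.
by rewrite /= sum_over_ht_aone mulrA.
Qed.
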